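(* Let $M$ be a matroid with cycle system $\mathcal{C}=\{C_1,\dots,C_g\}$, $g=g(M)$. 1. Let $e\in\mathcal{C}_{[g]}\cap C_i$. Then $\mathcal{C}'=\mathcal{C}\setminus\{C_i\}=\{C_1,\dots,C_{i-1},C_{i+1},\dots,C_g\}$ is a cycle system for $M\setminus e$. 2. Let $e$ be any non-loop of $M$. Then $\mathcal{C}''=\{C_1\setminus e,\dots,C_g\setminus e\}$ is a cycle system for $M/e$.
   Context: Matroids are on finite ground sets; $g(M)=|E(M)|-r(M)$ is the corank. A *cycle* of $M$ is a union of circuits of $M$. $M\setminus e$ and $M/e$ denote deletion and contraction, and $C_j\setminus e=C_j\setminus\{e\}$. Unique union: for a family $\mathcal{A}=\{A_1,\dots,A_g\}$ of subsets of a set and $\sigma\subseteq[g]=\{1,\dots,g\}$, $\mathcal{A}_\sigma$ is the set of elements $e\in\bigcup_{i\in\sigma}A_i$ for which there is exactly one $i\in\sigma$ with $e\in A_i$. A *cycle system* for $M$ is a collection $\mathcal{C}=\{C_1,\dots,C_g\}$ of cycles of $M$ with $g=g(M)$ such that for every nonempty $\sigma\subseteq[g]$ the unique union $\mathcal{C}_\sigma$ is dependent in $M$. *)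

(* Defs.v *)
From mathcomp Require Import all_boot.

Set Implicit Arguments.
Unset Strict Implicit.
Unset Printing Implicit Defensive.

(* A matroid lives on an arbitrary subset [ground] of the ambient finite type
   [T], so that [M], [M \ e] and [M / e] are all matroids over the same [T]. *)
Record matroid (T : finType) := Matroid {
  ground : {set T};
  indep : pred {set T};
  indep_ground : forall I : {set T}, indep I -> I \subset ground;
  indep0 : indep set0;
  indep_sub : forall I J : {set T}, J \subset I -> indep I -> indep J;
  indep_aug : forall I J : {set T}, indep I -> indep J -> #|I| < #|J| ->
    exists2 x, x \in J :\: I & indep (x |: I) }.

Section Matroids.
Variables (T : finType) (M : matroid T).
Implicit Types (A C I J : {set T}) (e : T).

Definition rank : nat := \max_(I : {set T} | indep M I) #|I|.

(* The truncated subtraction is exact: independent sets lie in the ground set. *)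
Definition corank : nat := #|ground M| - rank.

Definition dependent : pred {set T} :=
  [pred A : {set T} | (A \subset ground M) && ~~ indep M A].

Definition circuit : pred {set T} := [pred C : {set T} | minset dependent C].

Definition cycle (A : {set T}) : Prop :=
  exists P : {set {set T}}, (forall C, C \in P -> circuit C) /\ A = cover P.

Definition loop : pred T := [pred e | circuit [set e]].

Section Minors.
Variable e : T.

Definition del_indep : pred {set T} :=
  [pred I : {set T} | (I \subset ground M :\ e) && indep M I].

Lemma del_ground I : del_indep I -> I \subset ground M :\ e.
Proof. by case/andP. Qed.

Lemma del_indep0 : del_indep set0.
Proof. by rewrite /del_indep /= sub0set indep0. Qed.

Lemma del_indep_sub I J : J \subset I -> del_indep I -> del_indep J.
Proof.
move=> sJI /andP[sI iI]; apply/andP; split; first exact: subset_trans sI.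
exact: indep_sub iI.
Qed.

Lemma del_indep_aug I J : del_indep I -> del_indep J -> #|I| < #|J| ->
  exists2 x, x \in J :\: I & del_indep (x |: I).
Proof.
move=> /andP[sI iI] /andP[sJ iJ] /(indep_aug iI iJ)[x xJI ixI].
exists x => //; rewrite /del_indep /= ixI andbT subUset sI andbT sub1set.
by apply: (subsetP sJ); case/setDP: xJI.
Qed.

Definition deletion : matroid T :=
  Matroid del_ground del_indep0 del_indep_sub del_indep_aug.

(* The [else] branch covers a loop [e], for which M / e = M \ e. *)
Definition con_indep : pred {set T} :=
  [pred I : {set T} | (I \subset ground M :\ e) &&
     (if indep M [set e] then indep M (e |: I) else indep M I)].

Lemma con_ground I : con_indep I -> I \subset ground M :\ e.
Proof. by case/andP. Qed.

Lemma con_indep0 : con_indep set0.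
Proof. by rewrite /con_indep /= sub0set setU0 indep0; case: ifP. Qed.

Lemma con_indep_sub I J : J \subset I -> con_indep I -> con_indep J.
Proof.
move=> sJI /andP[sI iI]; apply/andP; split; first exact: subset_trans sI.
by case: ifP iI => _; apply: indep_sub; rewrite ?setUS.
Qed.

Lemma con_indep_aug I J : con_indep I -> con_indep J -> #|I| < #|J| ->
  exists2 x, x \in J :\: I & con_indep (x |: I).
Proof.
rewrite /con_indep /=; case: (indep M [set e]); last exact: del_indep_aug.
move=> /andP[sI iI] /andP[sJ iJ] ltIJ.
have eF A : A \subset ground M :\ e -> e \notin A.
  by move=> sA; apply/negP => /(subsetP sA); rewrite !inE eqxx.
have [|x] := indep_aug iI iJ; first by rewrite !cardsU1 !eF.
rewrite !inE negb_or => /andP[/andP[xe xI] /orP[/eqP ex|xJ]] ixI.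
  by rewrite ex eqxx in xe.
exists x; first by rewrite inE xI.
rewrite setUCA ixI andbT subUset sI andbT sub1set.
exact: (subsetP sJ).
Qed.

Definition contraction : matroid T :=
  Matroid con_ground con_indep0 con_indep_sub con_indep_aug.

End Minors.

Definition unique_union g (A : 'I_g -> {set T}) (s : {set 'I_g}) : {set T} :=
  [set e in \bigcup_(i in s) A i | #|[set i in s | e \in A i]| == 1].

(* The collection {C_1, ..., C_g} is an indexed family. Repetitions are
   excluded by the last condition, because C_i = C_j with i != j would make
   the unique union over {i, j} empty, hence independent. *)
Definition cycle_system g (C : 'I_g -> {set T}) : Prop :=
  [/\ g = corank,
      forall i, cycle (C i)
    & forall s : {set 'I_g}, s != set0 -> dependent (unique_union C s)].

End Matroids.

(* Main.v *)
(** A set A is a cycle iff it lies in the ground set and each x in A is spanned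
    by A :\ x. Passing to M / e, let D be a circuit through x inside a cycle A.
    Either e |: (D :\ x) is independent, and then D :\ x :\ e still spans x in
    M / e; or extending [set e] inside D :\ x gives an independent set K of
    size #|D :\ x| with e in K, and if x |: K were independent, augmenting
    D :\ x from it would make D or e |: (D :\ x) independent.
    The coranks follow from bases avoiding e (e lies on a circuit) and bases
    containing e (e is not a loop). *)
Require Import Defs.
From mathcomp Require Import all_boot.

Section Bases.
Set Implicit Arguments.
Unset Strict Implicit.
Variables (T : finType) (M : matroid T).
Implicit Types (I J K : {set T}) (x : T).

(** Augmentation is repeated, by induction on the deficit [#|J| - #|I|]. Every added element comes
    from [J], so [K] stays inside [I :|: J]; the contraction argument relies on this. *)
Lemma indep_extend I J : indep M I -> indep M J -> #|I| <= #|J| ->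
  exists K, [/\ I \subset K, K \subset I :|: J, indep M K & #|K| = #|J|].
Proof.
move=> iI iJ; move eqn: (#|J| - #|I|) => n.
elim: n I iI eqn => [|n IHn] I iI eqn leIJ.
  exists I; split; rewrite ?subsetUl //.
  by apply/eqP; rewrite eqn_leq leIJ -subn_eq0 eqn.
have [|x /setDP[xJ xI] ixI] := indep_aug iI iJ; first by rewrite -subn_gt0 eqn.
have cxI : #|x |: I| = #|I|.+1 by rewrite cardsU1 xI.
have [||K [sIK sK iK cK]] := IHn (x |: I) ixI.
- by rewrite cxI subnS eqn.
- by rewrite cxI -subn_gt0 eqn.
exists K; split=> //; first exact: subset_trans (subsetUr _ _) sIK.
apply: subset_trans sK _; rewrite -setUA subUset subxx sub1set !inE xJ.
by rewrite orbT.
Qed.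

Lemma leq_card_rank I : indep M I -> #|I| <= rank M.
Proof. by move=> iI; rewrite /rank (leq_bigmax_cond _ iI). Qed.

Lemma basis_exists I : indep M I ->
  exists B : {set T}, [/\ I \subset B, indep M B & #|B| = rank M].
Proof.
(* The maximum defining the rank is attained, since [set0] is independent. *)
move=> iI; have [|B iB rB] := @eq_bigmax_cond _ (indep M) (fun I : {set T} => #|I|).
  by apply/card_gt0P; exists set0; apply: indep0.
have [|K [sIK _ iK cK]] := indep_extend iI iB; last first.
  by exists K; split; rewrite // cK -rB.
by rewrite -rB leq_card_rank.
Qed.

End Bases.

Section Circuits.
Set Implicit Arguments.
Unset Strict Implicit.
Variables (T : finType) (M : matroid T).
Implicit Types (A D I : {set T}) (e x : T).

Lemma circuit_dependent D : circuit M D -> dependent M D.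
Proof. exact: minsetp. Qed.

Lemma circuit_sub_ground D : circuit M D -> D \subset ground M.
Proof. by case/circuit_dependent/andP. Qed.

Lemma circuit_indepD1 D x : circuit M D -> x \in D -> indep M (D :\ x).
Proof.
move=> cD xD; apply/negPn/negP => nI.
have /minsetP[_ minD] : minset (dependent M) D := cD.
have /setP/(_ x) : D :\ x = D.
  apply: minD; last exact: subsetDl.
  by apply/andP; rewrite (subset_trans (subsetDl _ _)) ?circuit_sub_ground.
by rewrite !inE eqxx xD.
Qed.

Lemma cycle_circuit A x : Defs.cycle M A -> x \in A ->
  exists D, [/\ circuit M D, D \subset A & x \in D].
Proof.
move=> [P [cP ->]] /bigcupP[D DP xD].
by exists D; split; rewrite ?cP //; apply: (bigcup_max D).
Qed.

Lemma cycle_sub_ground A : Defs.cycle M A -> A \subset ground M.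
Proof.
move=> cA; apply/subsetP => x /(cycle_circuit cA)[D [cD _ xD]].
exact: (subsetP (circuit_sub_ground cD)).
Qed.

(** A circuit inside [x |: I] must contain [x], because [I] is independent. Hence the circuits
    inside [A] cover [A]. *)
Lemma spanned_cycle A : A \subset ground M ->
    (forall x, x \in A ->
       exists I, [/\ I \subset A, indep M I & ~~ indep M (x |: I)]) ->
  Defs.cycle M A.
Proof.
move=> sA spA; exists [set D : {set T} | circuit M D & D \subset A].
split=> [D|]; first by rewrite inE => /andP[].
apply/setP => x; apply/idP/bigcupP => [xA|[D]]; last first.
  by rewrite inE => /andP[_ /subsetP]; apply.
have [I [sI iI dI]] := spA x xA.
have sxA : x |: I \subset A by rewrite subUset sub1set xA.
have [|D cD sD] := @minset_exists _ (dependent M) (x |: I).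
  by apply/andP; rewrite (subset_trans sxA sA).
exists D; first by rewrite inE; apply/andP; split=> //; apply: subset_trans sxA.
apply: contraLR dI => xD.
have /andP[_ /negP[]] := circuit_dependent cD.
by apply: indep_sub iI; apply/subsetP => y yD; have := subsetP sD y yD;
  rewrite !inE; case: eqP => // yx; rewrite -yx yD in xD.
Qed.

Lemma nonloop_indep e : e \in ground M -> ~~ loop M e -> indep M [set e].
Proof.
move=> eM; apply: contraR => dE; apply/minsetP; split.
  by apply/andP; rewrite sub1set.
move=> B /andP[_ dB]; rewrite subset1 => /orP[/eqP // | /eqP B0].
by rewrite B0 indep0 in dB.
Qed.

End Circuits.

Section Minors.
Set Implicit Arguments.
Unset Strict Implicit.
Variables (T : finType) (M : matroid T).
Implicit Types (A D : {set T}) (e : T).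

(** Extend [D :\ e] to a basis of [M]. It avoids [e], since otherwise it would contain [D], so it is
    still independent after the deletion. *)
Lemma rank_deletion D e : circuit M D -> e \in D ->
  rank (deletion M e) = rank M.
Proof.
move=> cD eD; apply/eqP; rewrite eqn_leq; apply/andP; split.
  by apply/bigmax_leqP => I /andP[_ iI]; apply: leq_card_rank.
have [B [sB iB <-]] := basis_exists (circuit_indepD1 cD eD).
have dB : del_indep M e B; last exact: (leq_bigmax_cond _ dB).
rewrite /del_indep /= iB andbT subsetD1 indep_ground //=.
apply/negP => eB; have /andP[_ /negP[]] := circuit_dependent cD.
by apply: indep_sub iB; rewrite -(setD1K eD) subUset sub1set eB.
Qed.

Lemma corank_deletion D e : circuit M D -> e \in D ->
  corank (deletion M e) = (corank M).-1.
Proof.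
move=> cD eD; have eM := subsetP (circuit_sub_ground cD) e eD.
by rewrite /corank (rank_deletion cD eD) (cardsD1 e (ground M)) eM subSKn.
Qed.

(** Removing [e] turns a basis of [M] through [e] into an independent set of the contraction; adding
    [e] to a basis of the contraction goes back. *)
Lemma rank_contraction e : indep M [set e] ->
  rank M = (rank (contraction M e)).+1.
Proof.
move=> ie; apply/eqP; rewrite eqn_leq; apply/andP; split.
  have [B [sB iB <-]] := basis_exists ie.
  have eB : e \in B by rewrite -sub1set.
  have cB : con_indep M e (B :\ e).
    by rewrite /con_indep /= ie setD1K // iB setSD ?indep_ground.
  by rewrite (cardsD1 e B) eB ltnS; apply: (leq_bigmax_cond _ cB).
have [B [_ cB <-]] := basis_exists (indep0 (contraction M e)).
have /andP[] : con_indep M e B := cB.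
rewrite ie subsetD1 => /andP[_ eB] /leq_card_rank.
by rewrite cardsU1 eB.
Qed.

Lemma corank_contraction e : indep M [set e] ->
  corank (contraction M e) = corank M.
Proof.
move=> ie; have eM : e \in ground M by rewrite -sub1set indep_ground.
by rewrite /corank (rank_contraction ie) (cardsD1 e (ground M)) eM subSS.
Qed.

Lemma dependent_deletion e A :
  dependent M A -> e \notin A -> dependent (deletion M e) A.
Proof.
by move=> /andP[sA dA] eA; rewrite /dependent /= /del_indep /= subsetD1 sA eA.
Qed.

Lemma dependent_contraction e A : indep M [set e] ->
  dependent M A -> dependent (contraction M e) (A :\ e).
Proof.
move=> ie /andP[sA dA]; rewrite /dependent /= /con_indep /= ie setSD //=.
by apply: contra dA; apply: indep_sub; apply/subsetP => x xA;
  rewrite !inE xA andbT orbN.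
Qed.

(** The circuits covering [A] all avoid [e], and for sets avoiding [e] dependence is the same in [M]
    and in the deletion, so they remain circuits. *)
Lemma cycle_deletion e A : Defs.cycle M A -> e \notin A ->
  Defs.cycle (deletion M e) A.
Proof.
move=> [P [cP ->]] eP; exists P; split=> // D DP.
have eD : e \notin D by apply: contra eP => eD; apply/bigcupP; exists D.
apply/minsetP; split.
  exact: dependent_deletion (circuit_dependent (cP D DP)) eD.
have /minsetP[_ minD] : minset (dependent M) D := cP D DP.
move=> B dB sB; apply: minD => //; move: dB.
rewrite /dependent /= /del_indep /= => /andP[sBe]; rewrite sBe /= => ->.
by rewrite andbT (subset_trans sBe) ?subsetDl.
Qed.

Lemma cycle_contraction e A : indep M [set e] ->
  Defs.cycle M A -> Defs.cycle (contraction M e) (A :\ e).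
Proof.
move=> ie cA; apply: spanned_cycle; first by rewrite setSD ?cycle_sub_ground.
move=> x /setD1P[xe xA]; have [D [cD sDA xD]] := cycle_circuit cA xA.
have /andP[_ dD] := circuit_dependent cD.
have iJ := circuit_indepD1 cD xD; have DE := setD1K xD.
set J := D :\ x in iJ DE; have sJA : J \subset A.
  exact: subset_trans (subsetDl _ _) sDA.
(* Since [K] contains [e], independence of [K :\ e] and dependence of [x |: (K :\ e)] in the
   contraction are read off from [K] and [x |: K] in [M]. *)
suff [K [eK sK iK dK]] : exists K : {set T},
    [/\ e \in K, K \subset e |: J, indep M K & ~~ indep M (x |: K)].
  exists (K :\ e); rewrite /= /con_indep /= ie setUCA setD1K //; split.
  - apply/subsetP => y /setD1P[ye /(subsetP sK)]; rewrite !inE (negPf ye) /=.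
    by move=> /andP[_ yD]; rewrite (subsetP sDA).
  - by rewrite iK andbT setSD ?indep_ground.
  - by rewrite negb_and dK orbT.
have [iEJ | dEJ] := boolP (indep M (e |: J)).
  exists (e |: J); split; rewrite ?setU11 //; apply: contra dD.
  by apply: indep_sub; rewrite -DE setUS ?subsetUr.
(* [J] is nonempty: otherwise [e |: J] would be [[set e]], which is independent. *)
have leJ : #|[set e]| <= #|J|.
  rewrite cards1 card_gt0; apply: contraNneq dEJ => ->; by rewrite setU0.
have [K [sEK sK iK cK]] := indep_extend ie iJ leJ.
exists K; split=> //; first by rewrite -sub1set.
apply/negP => ixK; have [|y] := indep_aug iJ ixK.
  rewrite cardsU1 cK; case: (boolP (x \in K)) => // /(subsetP sK).
  by rewrite !inE eqxx (negPf xe).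
rewrite !inE => /andP[yJ /orP[/eqP-> | /(subsetP sK)]].
  by rewrite DE (negPf dD).
by rewrite !inE (negPf yJ) orbF => /eqP->; rewrite (negPf dEJ).
Qed.

End Minors.

Section UniqueUnion.
Variables (T : finType) (g : nat) (C : 'I_g -> {set T}).

(** Injectivity preserves the number of indices whose set contains a given element. With [lift i]
    for [f], this reads a subfamily avoiding [C i] as a subfamily of [C]. *)
Lemma unique_union_imset g' (f : 'I_g' -> 'I_g) (s : {set 'I_g'}) :
  injective f ->
  unique_union (fun j => C (f j)) s = unique_union C (f @: s).
Proof.
move=> injf; apply/setP => x; rewrite !inE; congr andb.
  apply/bigcupP/bigcupP => [[j js xC]|[_ /imsetP[j js ->] xC]].
    by exists (f j); rewrite ?imset_f.
  by exists j.
rewrite -(card_imset _ injf); congr (_ == 1).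
apply: eq_card => i; rewrite [RHS]inE.
apply/imsetP/andP => [[j]|[/imsetP[j js ->] xC]].
  by rewrite inE => /andP[js xC] ->; rewrite imset_f.
by exists j; rewrite // inE js.
Qed.

Lemma unique_unionD1 (e : T) (s : {set 'I_g}) :
  unique_union (fun j => C j :\ e) s = unique_union C s :\ e.
Proof.
apply/setP => x; rewrite !inE; have [->|xe] := eqVneq x e.
  by apply/negbTE; rewrite negb_and; apply/orP; left;
    apply/bigcupP => -[j _]; rewrite !inE eqxx.
rewrite /=; congr andb; last first.
  by congr (_ == 1); apply: eq_card => j; rewrite !inE xe.
by apply/bigcupP/bigcupP => -[j js xC]; exists j; move: xC; rewrite // !inE xe.
Qed.

Lemma unique_unionT_inj (e : T) (i j : 'I_g) :
  e \in unique_union C setT -> e \in C i -> e \in C j -> i = j.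
Proof.
rewrite inE => /andP[_ /cards1P[k Ek]] ei ej.
have in1 l : e \in C l -> l = k.
  by move=> el; apply/set1P; rewrite -Ek !inE.
by rewrite (in1 i ei) (in1 j ej).
Qed.

End UniqueUnion.

Theorem proposition3p6 (T : finType) (M : matroid T) (g : nat)
    (C : 'I_g -> {set T}) (hC : cycle_system M C) :
  (forall (i : 'I_g) (e : T),
     e \in unique_union C [set: 'I_g] :&: C i ->
     cycle_system (deletion M e) (fun j : 'I_g.-1 => C (lift i j))) /\
  (forall e : T, e \in ground M -> ~~ loop M e ->
     cycle_system (contraction M e) (fun j : 'I_g => C j :\ e)).
Proof.
case: hC => gM cC dC; split=> [i e /setIP[eU ei] | e eM eL].
  (* Only [C i] contains [e], so the remaining cycles survive the deletion unchanged. *)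
  have eC j : e \notin C (lift i j).
    by apply: contra (neq_lift i j) => ej; apply/eqP; apply: unique_unionT_inj ej.
  (* A circuit through [e] ensures that the deletion keeps the rank, so the corank drops by exactly
     one. *)
  have [D [cD _ eD]] := cycle_circuit (cC i) ei.
  split=> [|j|s s0]; first by rewrite (corank_deletion cD eD) -gM.
    exact: cycle_deletion.
  apply: dependent_deletion.
    rewrite unique_union_imset; last exact: lift_inj.
    by apply: dC; rewrite imset_eq0.
  rewrite inE negb_and; apply/orP; left.
  by apply/bigcupP => -[j _]; apply/negP.
have ie := nonloop_indep eM eL.
split=> [|j|s s0]; first by rewrite corank_contraction.
  exact: cycle_contraction.
by rewrite unique_unionD1; apply: dependent_contraction; last exact: dC.
Qed.
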